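(* Let $C$ be a subset of a $W$-hyperbolic space $X$ and let $T:C\to C$ be a $\lambda$-firmly nonexpansive mapping with $\lambda\in(0,1)$. If $T$ has bounded orbits, then $T$ is asymptotically regular, i.e. $\lim_{n\to\infty}d(T^nx,T^{n+1}x)=0$ for all $x\in C$.
   Context: A $W$-hyperbolic space $(X,d,W)$ is a metric space $(X,d)$ together with a map $W:X\times X\times[0,1]\to X$ (a convexity mapping) such that for all $x,y,z,w\in X$ and $\lambda,\tilde\lambda\in[0,1]$: (W1) $d(z,W(x,y,\lambda))\le(1-\lambda)d(z,x)+\lambda d(z,y)$; (W2) $d(W(x,y,\lambda),W(x,y,\tilde\lambda))=|\lambda-\tilde\lambda|\,d(x,y)$; (W3) $W(x,y,\lambda)=W(y,x,1-\lambda)$; (W4) $d(W(x,z,\lambda),W(y,w,\lambda))\le(1-\lambda)d(x,y)+\lambda d(z,w)$. One writes $(1-\lambda)x\oplus\lambda y:=W(x,y,\lambda)$. For $C\subseteq X$ and $\lambda\in(0,1)$, a map $T:C\to X$ is $\lambda$-firmly nonexpansive if $d(Tx,Ty)\le d((1-\lambda)x\oplus\lambda Tx,(1-\lambda)y\oplus\lambda Ty)$ for all $x,y\in C$. Such a map is nonexpansive, i.e. $d(Tx,Ty)\le d(x,y)$ for all $x,y\in C$. For $T:C\to C$ nonexpansive, the orbit of $x\in C$ is $\{T^nx\mid n=0,1,2,\ldots\}$; $T$ has bounded orbits if the orbit of some (equivalently, every) $x\in C$ is bounded. *)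

(* Defs.v *)
From mathcomp Require Import all_boot all_order all_algebra.
From mathcomp Require Import all_classical all_reals.
From mathcomp Require Import topology normedtype sequences.

Set Implicit Arguments.
Unset Strict Implicit.
Unset Printing Implicit Defensive.

Import Order.TTheory GRing.Theory Num.Theory.
Import numFieldNormedType.Exports.

Local Open Scope classical_set_scope.
Local Open Scope ring_scope.

(* [W x y l] is [(1 - l) x (+) l y].  A map on [X * X * [0, 1]] is encoded as a
   function total in its real argument: all axioms are restricted to [0, 1], so
   the values of [W] at other parameters are irrelevant. *)
Record W_hyperbolic (R : realType) (X : metricType R) (W : X -> X -> R -> X)
    : Prop := {
  W_hyperbolic1 : forall (x y z : X) (l : R), 0 <= l <= 1 ->
    mdist z (W x y l) <= (1 - l) * mdist z x + l * mdist z y;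
  W_hyperbolic2 : forall (x y : X) (l m : R), 0 <= l <= 1 -> 0 <= m <= 1 ->
    mdist (W x y l) (W x y m) = `|l - m| * mdist x y;
  W_hyperbolic3 : forall (x y : X) (l : R), 0 <= l <= 1 ->
    W x y l = W y x (1 - l);
  W_hyperbolic4 : forall (x y z w : X) (l : R), 0 <= l <= 1 ->
    mdist (W x z l) (W y w l) <= (1 - l) * mdist x y + l * mdist z w
}.

(* Only the values of [T] on [C] matter. *)
Definition firmly_nonexpansive (R : realType) (X : metricType R)
    (W : X -> X -> R -> X) (l : R) (C : set X) (T : X -> X) : Prop :=
  forall x y : X, C x -> C y ->
    mdist (T x) (T y) <= mdist (W x (T x) l) (W y (T y) l).

Definition iter_orbit (X : Type) (T : X -> X) (x : X) : set X :=
  range (fun n : nat => iter n T x).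

(* The library's [bounded_set] is only available on normed modules. *)
Definition metric_bounded (R : realType) (X : metricType R) (A : set X) : Prop :=
  exists M : R, forall x y : X, A x -> A y -> mdist x y <= M.

(* For nonexpansive [T : C -> C], one bounded orbit makes all of them bounded. *)
Definition bounded_orbits (R : realType) (X : metricType R) (C : set X)
    (T : X -> X) : Prop :=
  exists2 x : X, C x & metric_bounded (iter_orbit T x).

Definition asymptotically_regular (R : realType) (X : metricType R)
    (C : set X) (T : X -> X) : Prop :=
  forall x : X, C x ->
    mdist (iter n T x) (iter n.+1 T x) @[n --> \oo] --> (0 : R).

(* Main.v *)
(** Put [x_n = T^n x] and [a_k n = d(x_n, x_(n+k))].  As [T] is nonexpansive,
    each [a_k] is nonincreasing, so it has a limit [L_k].  Applying (W1) on both
    sides of the firm nonexpansiveness inequality for [x_n] and [x_(n+k+1)], and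
    letting [n] go to infinity, gives [2 L_(k+1) <= L_k + L_(k+2)]: the sequence
    [L] is convex.  Since [L_0 = 0], this yields [k L_1 <= L_k], and [L] is
    bounded because the orbit is; hence [L_1 = 0]. *)
Require Import Defs.
From mathcomp Require Import all_boot all_order all_algebra.
From mathcomp Require Import all_classical all_reals.
From mathcomp Require Import topology normedtype sequences.
From mathcomp Require Import ring lra.

Set Implicit Arguments.
Unset Strict Implicit.
Unset Printing Implicit Defensive.

Import Order.TTheory GRing.Theory Num.Theory.
Import numFieldNormedType.Exports.

Local Open Scope classical_set_scope.
Local Open Scope ring_scope.

(** Convexity makes the increments nondecreasing, so each is at least the first one, which is [u 1]
    because [u 0 = 0]. A positive [u 1] would then force linear growth past [M]. *)
Lemma convex_seq_bounded_le0 (R : archiRealFieldType) (u : nat -> R) (M : R) :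
  u 0%N = 0 -> (forall k, 2 * u k.+1 <= u k + u k.+2) ->
  (forall k, u k <= M) -> u 1%N <= 0.
Proof.
move=> u0 ucvx uM.
have slope k : u 1%N <= u k.+1 - u k.
  elim: k => [|k IH]; first by rewrite u0 subr0.
  by have := ucvx k; lra.
have lin k : k%:R * u 1%N <= u k.
  elim: k => [|k IH]; first by rewrite u0 mul0r.
  by have := slope k; rewrite -natr1 mulrDl mul1r; lra.
rewrite leNgt; apply/negP => u1.
(* An integer [k] above [M / u 1] gives the contradiction [M < k * u 1 <= u k]. *)
have := archi_boundP (normr_ge0 (M / u 1%N)).
set k := Num.bound _ => hk.
have : M < k%:R * u 1%N.
  by rewrite -ltr_pdivrMr// (le_lt_trans (ler_norm _) hk).
by apply/negP; rewrite -leNgt (le_trans (lin k)).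
Qed.

(** (W1) is used once in each argument. Unlike (W4), this keeps the cross distances, which along an
    orbit are the gaps of neighbouring order. *)
Lemma W_hyperbolic_mdist_le (R : realType) (X : metricType R)
    (W : X -> X -> R -> X) (x x' y y' : X) (l : R) :
  W_hyperbolic W -> 0 <= l <= 1 ->
  mdist (W x x' l) (W y y' l) <=
    (1 - l) ^+ 2 * mdist x y + l ^+ 2 * mdist x' y' +
    (1 - l) * l * (mdist x' y + mdist x y').
Proof.
move=> hW hl; have /andP[l0 l1] := hl.
have W1 z : mdist (W x x' l) z <= (1 - l) * mdist x z + l * mdist x' z.
  by have := W_hyperbolic1 hW x x' z hl; rewrite !(metric_sym z).
apply: (le_trans (W_hyperbolic1 hW y y' (W x x' l) hl)).
have l1' : 0 <= 1 - l by rewrite subr_ge0.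
apply: (le_trans (lerD (ler_wpM2l l1' (W1 y)) (ler_wpM2l l0 (W1 y')))).
lra.
Qed.

Section firmly_nonexpansive_orbits.
Context (R : realType) (X : metricType R) (W : X -> X -> R -> X).
Context (hW : W_hyperbolic W) (C : set X) (T : {fun C >-> C}) (l : R).
Context (hl : 0 < l < 1) (hT : firmly_nonexpansive W l C T).

Let l01 : 0 <= l <= 1.
Proof. by case/andP: hl => l0 l1; rewrite !ltW. Qed.

(** (W4) bounds the right side of firm nonexpansiveness by a combination containing
    [l * mdist (T x) (T y)]; absorb this term on the left and cancel [1 - l > 0]. *)
Lemma firmly_nonexpansive_nonexpansive (x y : X) : C x -> C y ->
  mdist (T x) (T y) <= mdist x y.
Proof.
move=> Cx Cy; have /andP[_ l1] := hl.
have := le_trans (hT Cx Cy) (W_hyperbolic4 hW x y (T x) (T y) l01).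
rewrite -lerBlDr -{1}[mdist (T x) (T y)]mul1r -mulrBl ler_pM2l//.
by rewrite subr_gt0.
Qed.

Lemma iter_funS (x : X) n : C x -> C (iter n T x).
Proof. by move=> Cx; elim: n => //= n IH; exact: funS. Qed.

Lemma iter_nonexpansive (x y : X) n : C x -> C y ->
  mdist (iter n T x) (iter n T y) <= mdist x y.
Proof.
move=> Cx Cy; elim: n => //= n; apply: le_trans.
by apply: firmly_nonexpansive_nonexpansive; exact: iter_funS.
Qed.

Lemma bounded_orbits_bounded (x : X) : C x -> bounded_orbits C T ->
  metric_bounded (iter_orbit T x).
Proof.
move=> Cx [x0 Cx0 [M hM]]; exists (mdist x x0 + M + mdist x x0).
move=> _ _ [n _ <-] [m _ <-].
apply: (le_trans (metric_triangle _ (iter m T x0) _)); apply: lerD.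
  apply: (le_trans (metric_triangle _ (iter n T x0) _)); apply: lerD.
    exact: iter_nonexpansive.
  by apply: hM; [exists n | exists m].
by rewrite metric_sym; exact: iter_nonexpansive.
Qed.

Lemma cvg_mdist_iter (x : X) k : C x ->
  cvgn (fun n => mdist (iter n T x) (iter (n + k) T x)).
Proof.
move=> Cx; apply: nonincreasing_is_cvgn; last first.
  by exists 0 => _ [n _ <-]; exact: mdist_ge0.
by apply/nonincreasing_seqP => n;
  apply: firmly_nonexpansive_nonexpansive; exact: iter_funS.
Qed.

Lemma firmly_nonexpansive_gap_convex (x : X) (L : nat -> R) : C x ->
  (forall k, mdist (iter n T x) (iter (n + k) T x) @[n --> \oo] --> L k) ->
  forall k, 2 * L k.+1 <= L k + L k.+2.
Proof.
move=> Cx Lcvg k; have /andP[l0 l1] := hl.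
pose a k n := mdist (iter n T x) (iter (n + k) T x).
(* The recursion below mixes the indices [n] and [n.+1]; shifting does not change the limit. *)
have acvgS j : a j n.+1 @[n --> \oo] --> L j.
  by have := Lcvg j; rewrite -cvg_shiftS.
(* The points are [x_n] and [x_(n+k+1)]: applying [T] to the first only shortens the gap to [k], to
   the second only lengthens it to [k+2]. *)
have rec n : a k.+1 n.+1 <=
    (1 - l) ^+ 2 * a k.+1 n + l ^+ 2 * a k.+1 n.+1 +
    (1 - l) * l * (a k n.+1 + a k.+2 n).
  have Cn := @iter_funS x n Cx; have Cnk := @iter_funS x (n + k.+1) Cx.
  apply: (le_trans (hT Cn Cnk)).
  apply: (le_trans (W_hyperbolic_mdist_le _ _ _ _ hW l01)).
  by rewrite /a !addnS !addSn.
have lim : L k.+1 <= (1 - l) ^+ 2 * L k.+1 + l ^+ 2 * L k.+1 +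
    (1 - l) * l * (L k + L k.+2).
  apply: (ler_cvg_to (acvgS k.+1)); last by near=> n; exact: rec.
  apply: cvgD; first by apply: cvgD; apply: cvgMl_tmp; [exact: Lcvg|].
  by apply: cvgMl_tmp; apply: cvgD; [|exact: Lcvg].
(* Since [1 - (1 - l)^2 - l^2 = 2 (1 - l) l], [lim] is the claim multiplied by [(1 - l) * l]. *)
have pos : 0 < (1 - l) * l by rewrite mulr_gt0// subr_gt0.
rewrite -(ler_pM2l pos) -subr_ge0.
rewrite -subr_ge0 in lim; apply: (le_trans lim).
lra.
Unshelve. all: by end_near. Qed.

End firmly_nonexpansive_orbits.

Theorem corollary5p3 (R : realType) (X : metricType R) (W : X -> X -> R -> X)
    (hW : W_hyperbolic W) (C : set X) (T : {fun C >-> C}) (l : R)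
    (hl : 0 < l < 1) (hT : firmly_nonexpansive W l C T)
    (hb : bounded_orbits C T) :
  asymptotically_regular C T.
Proof.
move=> x Cx.
pose a k n := mdist (iter n T x) (iter (n + k) T x).
pose L k := limn (a k).
have acvg k : a k @ \oo --> L k := cvg_mdist_iter hW hl hT (k := k) Cx.
have [M hM] := bounded_orbits_bounded hW hl hT Cx hb.
have L0 : L 0%N = 0.
  rewrite /L (_ : a 0%N = cst 0) ?lim_cst//.
  by apply/funext => n; rewrite /a addn0 mdistxx.
(* [M] bounds the diameter of the whole orbit, hence every gap, uniformly in [k]. *)
have LM k : L k <= M.
  apply: limr_le; first exact: acvg.
  by near=> n; apply: hM; [exists n | exists (n + k)%N].
have L1_ge0 : 0 <= L 1%N.
  by apply: limr_ge; [exact: acvg | near=> n; exact: mdist_ge0].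
have Lcvx := firmly_nonexpansive_gap_convex hW hl hT Cx acvg.
have L1_le0 := convex_seq_bounded_le0 L0 Lcvx LM.
have L1 : L 1%N = 0 by apply/eqP; rewrite eq_le L1_le0.
rewrite -L1; have -> : (fun n => mdist (iter n T x) (iter n.+1 T x)) = a 1%N.
  by apply/funext => n; rewrite /a addn1.
exact: acvg.
Unshelve. all: by end_near. Qed.
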